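(* Let $p\in[1,\infty)$. The space $\Lambda_p(\mathbb{R}^d)$, endowed with $\|\cdot\|_{\alpha_p}$, is not locally convex.
   Context: $\mathbb{R}^d$ is endowed with the Borel $\sigma$-algebra and the Lebesgue measure, denoted $|\cdot|$. $\Lambda_p(\mathbb{R}^d)$ is the vector space of real-valued measurable functions $f$ on $\mathbb{R}^d$ (identified a.e.) such that for every $\delta>0$ there exists a measurable set $E_\delta$ with $|E_\delta|<\delta$ and $f\chi_{E_\delta^c}\in L_p(\mathbb{R}^d)$. It carries the topology induced by the metric $(f,g)\mapsto\|f-g\|_{\alpha_p}$, where $\|f\|_{\alpha_p}=\|\min(|f|,1)\|_p$ and $\|\cdot\|_p$ is the $L_p$ norm. The space is locally convex if it has a base of neighborhoods at zero consisting of convex neighborhoods. *)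

(* Defs.v *)
From HB Require Import structures.
From mathcomp Require Import all_boot all_order all_algebra.
From mathcomp Require Import all_classical all_reals all_analysis measurable_realfun.
Import Order.TTheory GRing.Theory Num.Def Num.Theory.
Import numFieldNormedType.Exports.

Set Implicit Arguments.
Unset Strict Implicit.
Unset Printing Implicit Defensive.

Local Open Scope classical_set_scope.
Local Open Scope ring_scope.

(* R^n is modelled by n.-tuple (measurableTypeR R), whose sigma-algebra is
   generated by the coordinate maps, i.e. is the Borel sigma-algebra of R^n.
   Lebesgue measure on it is the n-fold product of the library's
   one-dimensional lebesgue_measure; lebesgue_measure_tuple_box below gives its
   value on boxes. *)
Section lebesgue_Rn.
Context (R : realType).
Notation Rn n := (n.-tuple (measurableTypeR R)).

Definition tuple_cons n (x : measurableTypeR R * Rn n) : Rn n.+1 :=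
  [the n.+1.-tuple _ of x.1 :: x.2].

Lemma measurable_tuple_cons n : measurable_fun [set: _] (@tuple_cons n).
Proof. by apply: measurable_cons. Qed.

Section step.
Variables (n : nat) (mu : {sigma_finite_measure set (Rn n) -> \bar R}).

Definition lebesgue_succ : set (Rn n.+1) -> \bar R :=
  pushforward (@lebesgue_measure R \x mu)%E (@tuple_cons n).

Let lebesgue_succ0 : lebesgue_succ set0 = 0%E.
Proof. by rewrite /lebesgue_succ /pushforward preimage_set0 measure0. Qed.

Let lebesgue_succ_ge0 A : (0 <= lebesgue_succ A)%E.
Proof. exact: integral_ge0. Qed.

Let lebesgue_succ_sigma_additive : semi_sigma_additive lebesgue_succ.
Proof.
move=> F mF tF mUF; rewrite /lebesgue_succ /pushforward preimage_bigcup.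
apply: measure_semi_sigma_additive.
- by move=> k; rewrite -[X in measurable X]setTI; exact: measurable_tuple_cons.
- apply/trivIsetP => /= i j _ _ ij; rewrite -preimage_setI.
  by move/trivIsetP : tF => /(_ _ _ _ _ ij) ->//; rewrite preimage_set0.
- rewrite -preimage_bigcup -[X in measurable X]setTI.
  exact: measurable_tuple_cons.
Qed.

HB.instance Definition _ := isMeasure.Build _ _ _ lebesgue_succ
  lebesgue_succ0 lebesgue_succ_ge0 lebesgue_succ_sigma_additive.

Let lebesgue_succ_sigma_finite : sigma_finite setT lebesgue_succ.
Proof.
have /sigma_finiteP[F [TF ndF Foo]] := sigma_finiteT (@lebesgue_measure R).
have /sigma_finiteP[G [TG ndG Goo]] := sigma_finiteT mu.
pose u (t : Rn n.+1) : measurableTypeR R * Rn n :=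
  (thead t, [tuple of behead t]).
have mu_ : measurable_fun setT u.
  apply/measurable_fun_pair; first exact: measurable_tnth.
  exact: measurable_behead.
have consK : cancel (@tuple_cons n) u.
  by case=> x t; rewrite /u theadE; congr pair; apply/val_inj.
exists (fun k => u @^-1` (F k `*` G k)).
  rewrite -preimage_bigcup (_ : \bigcup_i _ = setT) ?preimage_setT//.
  apply/seteqP; split => // -[x t] _.
  have [i _ Fix] : (\bigcup_i F i) x by rewrite -TF.
  have [j _ Gjt] : (\bigcup_j G j) t by rewrite -TG.
  exists (maxn i j) => //; split => /=.
    by move: x Fix; exact/subsetPset/ndF/leq_maxl.
  by move: t Gjt; exact/subsetPset/ndG/leq_maxr.
move=> k; have [mFk Fkoo] := Foo k; have [mGk Gkoo] := Goo k; split.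
  by rewrite -[X in measurable X]setTI; apply: mu_ => //; exact: measurableX.
rewrite /lebesgue_succ /pushforward -comp_preimage.
rewrite (_ : u \o _ = id); last by apply/funext => x /=; rewrite consK.
rewrite [ltLHS]product_measure1E// lte_mul_pinfty//.
by rewrite ge0_fin_numE.
Qed.

HB.instance Definition _ := Measure_isSigmaFinite.Build _ _ _ lebesgue_succ
  lebesgue_succ_sigma_finite.

End step.

Fixpoint lebesgue_measure_tuple n : {sigma_finite_measure set (Rn n) -> \bar R} :=
  match n with
  | 0 => @dirac _ (Rn 0) [tuple] R
  | n.+1 => lebesgue_succ (lebesgue_measure_tuple n)
  end.

Lemma lebesgue_measure_tuple_box n (A : 'I_n -> set (measurableTypeR R)) :
  (forall i, measurable (A i)) ->
  lebesgue_measure_tuple n [set t | forall i, A i (tnth t i)] =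
  (\prod_(i < n) lebesgue_measure (A i))%E.
Proof.
elim: n A => [|n IH] A mA.
  by rewrite big_ord0/= diracE mem_set//= => -[].
pose B := [set t : Rn n | forall i, A (lift ord0 i) (tnth t i)].
have mB : measurable B.
  rewrite (_ : B = \bigcap_(i in [set: 'I_n])
      ((fun t => tnth t i) @^-1` A (lift ord0 i))); last first.
    by apply/seteqP; split => [t Bt i _|t Bt i]; [exact: Bt|exact: (Bt i)].
  apply: fin_bigcap_measurable => // i _.
  by rewrite -[X in measurable X]setTI; exact: measurable_tnth.
rewrite big_ord_recl -(IH (fun i => A (lift ord0 i)))//= -product_measure1E//.
rewrite /lebesgue_succ /pushforward; congr (product_measure1 _ _ _).
apply/seteqP; split => -[x t] /=.
- move=> xt; split => [|i /=]; first exact: (xt ord0).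
  by have := xt (lift ord0 i); rewrite /tuple_cons tnthS.
- move=> [Ax Bt] i; have [j ->|->] := unliftP ord0 i; last exact: Ax.
  by rewrite /tuple_cons tnthS; exact: Bt.
Qed.

End lebesgue_Rn.

Lemma ae_and d (T : measurableType d) (R : realType)
    (mu : {measure set T -> \bar R}) (P Q : T -> Prop) :
  (\forall x \ae mu, P x) -> (\forall x \ae mu, Q x) ->
  \forall x \ae mu, P x /\ Q x.
Proof. by apply: filterS2. Qed.

(* The vector space of measurable functions modulo a.e. equality. *)
Section L0.
Context d (T : measurableType d) (R : realType).
Variable mu : {measure set T -> \bar R}.

Definition L0 : Type := {mfun_ mu, T >-> R}.
HB.instance Definition _ := Choice.on L0.
HB.instance Definition _ := EqQuotient.on L0.
Definition L0_fun (f : L0) : T -> R := repr f.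
Coercion L0_fun : L0 >-> Funclass.

Local Open Scope quotient_scope.
Implicit Types (f g h : L0) (u v : {mfun T >-> R}).

Definition L0_class u : L0 := \pi_L0 u.

Lemma L0_class_eq u v : L0_class u = L0_class v <-> u = v %[ae mu].
Proof. by split=> [/eqquotP/asboolP|uv]; [|apply/eqquotP/asboolP]. Qed.

Lemma L0_ext f g : (f : T -> R) = g %[ae mu] -> f = g.
Proof. by move=> fg; rewrite -[f]reprK -[g]reprK; exact/L0_class_eq. Qed.

Lemma L0_classE u : (L0_class u : T -> R) = u %[ae mu].
Proof. by apply/L0_class_eq; exact: (reprK (L0_class u)). Qed.

Lemma measurable_L0 f : measurable_fun [set: T] f.
Proof. exact: measurable_funPT. Qed.

Definition L0_zero : L0 := L0_class (0 : {mfun T >-> R}).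
Definition L0_opp f : L0 := L0_class (- (repr f : {mfun T >-> R})).
Definition L0_add f g : L0 := L0_class ((repr f : {mfun T >-> R}) + repr g).
Definition L0_scale (a : R) f : L0 := L0_class (a *: (repr f : {mfun T >-> R})).

Lemma L0_zeroE : (L0_zero : T -> R) = cst 0 %[ae mu].
Proof. exact: L0_classE. Qed.
Lemma L0_oppE f : (L0_opp f : T -> R) = \- f %[ae mu].
Proof. exact: L0_classE. Qed.
Lemma L0_addE f g : (L0_add f g : T -> R) = f \+ g %[ae mu].
Proof. exact: L0_classE. Qed.
Lemma L0_scaleE a f : (L0_scale a f : T -> R) = a \*: (f : T -> R) %[ae mu].
Proof. exact: L0_classE. Qed.

Lemma L0_addA : associative L0_add.
Proof.
move=> f g h; apply: L0_ext.
have := ae_and (L0_addE f (L0_add g h)) (L0_addE g h).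
have := ae_and (L0_addE (L0_add f g) h) (L0_addE f g).
apply: filterS2 => x [/(_ I) E1 /(_ I) E2] [/(_ I) E3 /(_ I) E4] _.
by rewrite E1/= E2/= E3/= E4/= addrA.
Qed.

Lemma L0_addC : commutative L0_add.
Proof. by move=> f g; rewrite /L0_add addrC. Qed.

Lemma L0_add0 : left_id L0_zero L0_add.
Proof.
move=> f; apply: L0_ext; move: (L0_addE L0_zero f) L0_zeroE.
by apply: filterS2 => x /(_ I) -> /(_ I) /= -> _; rewrite add0r.
Qed.

Lemma L0_addN : left_inverse L0_zero L0_opp L0_add.
Proof.
move=> f; apply: L0_ext; move: (L0_addE (L0_opp f) f) (L0_oppE f) L0_zeroE.
by apply: filterS3 => x /(_ I) -> /(_ I) /= -> /(_ I) -> _; rewrite addNr.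
Qed.

HB.instance Definition _ :=
  GRing.isZmodule.Build L0 L0_addA L0_addC L0_add0 L0_addN.

Lemma L0_scaleA a b f : L0_scale a (L0_scale b f) = L0_scale (a * b) f.
Proof.
apply: L0_ext; move: (L0_scaleE a (L0_scale b f)) (L0_scaleE b f).
move: (L0_scaleE (a * b) f); apply: filterS3.
by move=> x /(_ I) -> /(_ I) -> /(_ I) /= -> _; rewrite scalerA.
Qed.

Lemma L0_scale1 : left_id 1 L0_scale.
Proof. by move=> f; rewrite /L0_scale scale1r; exact: reprK. Qed.

Lemma L0_scaleDr : right_distributive L0_scale +%R.
Proof.
move=> a f g; apply: L0_ext.
have := ae_and (L0_scaleE a (f + g)) (L0_addE f g).
move: (L0_addE (L0_scale a f) (L0_scale a g)).
have := ae_and (L0_scaleE a f) (L0_scaleE a g).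
apply: filterS3 => x [/(_ I) E2 /(_ I) E3] /(_ I) E1 [/(_ I) E4 /(_ I) E5] _.
by rewrite E4/= [L0_fun _ x]E5/= E1/= E2 E3/= scalerDr.
Qed.

Lemma L0_scaleDl f : {morph L0_scale^~ f : a b / a + b}.
Proof.
move=> a b; apply: L0_ext.
move: (L0_scaleE (a + b) f) (L0_addE (L0_scale a f) (L0_scale b f)).
have := ae_and (L0_scaleE a f) (L0_scaleE b f).
apply: filterS3 => x [/(_ I) E1 /(_ I) E2] /(_ I) E3 /(_ I) E4 _.
by rewrite E3/= E4/= E1 E2/= scalerDl.
Qed.

HB.instance Definition _ :=
  GRing.Zmodule_isLmodule.Build R L0 L0_scaleA L0_scale1 L0_scaleDr L0_scaleDl.

Lemma L00E : ((0 : L0) : T -> R) = cst 0 %[ae mu].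
Proof. exact: L0_zeroE. Qed.
Lemma L0NE f : ((- f : L0) : T -> R) = \- f %[ae mu].
Proof. exact: L0_oppE. Qed.
Lemma L0DE f g : ((f + g : L0) : T -> R) = f \+ g %[ae mu].
Proof. exact: L0_addE. Qed.
Lemma L0ZE a f : ((a *: f : L0) : T -> R) = a \*: (f : T -> R) %[ae mu].
Proof. exact: L0_scaleE. Qed.

End L0.

Section Lnorm_ae.
Context d (T : measurableType d) (R : realType).
Variables (mu : {measure set T -> \bar R}) (p : R) (p1 : 1 <= p).
Implicit Types u v : T -> R.

Lemma le_Lnorm_ae u v : measurable_fun setT u -> measurable_fun setT v ->
  (\forall x \ae mu, `|u x| <= `|v x|) ->
  ('N[mu]_p%:E[EFin \o u] <= 'N[mu]_p%:E[EFin \o v])%E.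
Proof.
move=> mu_ mv uv; have p0 : 0 < p by exact: lt_le_trans p1.
have mpow (w : T -> R) : measurable_fun setT w ->
    measurable_fun setT (fun x => `|(EFin \o w) x| `^ p)%E.
  move=> mw; apply/measurable_EFinP.
  apply: (@measurableT_comp _ _ _ _ _ _ (@powR R ^~ p)) => //.
  exact: measurableT_comp.
rewrite unlock; apply: gt0_ler_poweR.
- by rewrite invr_ge0 ltW.
- by rewrite in_itv/= leey integral_ge0// => x _; exact: poweR_ge0.
- by rewrite in_itv/= leey integral_ge0// => x _; exact: poweR_ge0.
- apply: ae_ge0_le_integral => //.
  + by move=> x _; exact: poweR_ge0.
  + exact: mpow.
  + by move=> x _; exact: poweR_ge0.
  + exact: mpow.
  + move: uv; apply: filterS => x uvx _.
    by rewrite /= lee_fin ge0_ler_powR ?nnegrE ?normr_ge0 ?(ltW p0).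
Qed.

Lemma finite_norm_indic E : measurable E -> (mu E < +oo)%E ->
  finite_norm mu p%:E (\1_E : T -> R).
Proof.
move=> mE Eoo; have p0 : 0 < p by exact: lt_le_trans p1.
rewrite /finite_norm unlock poweR_lty//.
rewrite (eq_integral (fun x => (\1_E x)%:E)); last first.
  move=> x _; rewrite /= indicE.
  by case: (x \in E); rewrite ?normr1 ?powR1// normr0 powR0// gt_eqF.
by rewrite integral_indic// setIT.
Qed.

End Lnorm_ae.

Section Lambda.
Context d (T : measurableType d) (R : realType).
Variables (mu : {measure set T -> \bar R}) (p : R).

(* Elements of L0 are applied through their chosen representative; both
   in_Lambda and alpha_norm are invariant under a.e. equality. *)
Definition in_Lambda (f : L0 mu) := forall delta : R, 0 < delta ->
  exists E, [/\ measurable E, (mu E < delta%:E)%E &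
    ((f : T -> R) \* \1_(~` E)) \in Lfun mu p%:E].

Definition alpha_norm (f : L0 mu) : \bar R :=
  'N[mu]_p%:E[EFin \o (fun x => minr `|f x| 1)%R]%E.

(* p1 is a phantom argument: it makes the instances below inferable. *)
Definition Lambda_pred of 1 <= p : {pred L0 mu} := mem [set f | in_Lambda f].

Variable p1 : 1 <= p.

Let p1E : (1 <= p%:E)%E. Proof. by rewrite lee_fin. Qed.

Let measurable_mul_indic (f : L0 mu) E : measurable E ->
  measurable_fun setT ((f : T -> R) \* \1_E).
Proof.
move=> mE; apply: measurable_funM; first exact: measurable_L0.
exact: measurable_indic.
Qed.

Lemma in_LambdaD a (f g : L0 mu) :
  in_Lambda f -> in_Lambda g -> in_Lambda (a *: f + g).
Proof.
move=> Lf Lg delta delta0.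
have delta20 : 0 < delta / 2 by rewrite divr_gt0.
have [E [mE muE fE]] := Lf _ delta20; have [F [mF muF gF]] := Lg _ delta20.
have mEF : measurable (E `|` F) by exact: measurableU.
exists (E `|` F); split => //.
  apply: (le_lt_trans (measureU2 _ mE mF)).
  by rewrite [in ltRHS](splitr delta) EFinD lteD.
set u := a *: ((f : T -> R) \* \1_(~` E)) + ((g : T -> R) \* \1_(~` F)).
have : u \in Lfun mu p%:E by case: (Lfun_submod_closed mu p1E) => _; apply.
rewrite !inE => /andP[/[!inE]/= mu_ uoo].
have mfg := @measurable_mul_indic (a *: f + g) _ (measurableC mEF).
apply/andP; split; rewrite inE//=.
apply: le_lt_trans uoo; apply: le_Lnorm_ae => //.
move: (L0DE (a *: f) g) (L0ZE a f); apply: filterS2 => x /(_ I) E1 /(_ I) E2.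
rewrite /= E1/= E2 /u/=.
rewrite -[X in _ <= `|X|]/(a * (f x * \1_(~` E) x) + g x * \1_(~` F) x).
rewrite !indicE !in_setC in_setU negb_or.
by case: (x \in E); case: (x \in F); rewrite /= ?mulr0 ?mulr1 ?normr0.
Qed.

Lemma Lambda_submod_closed : submod_closed (Lambda_pred p1).
Proof.
split.
  rewrite inE => /= delta delta0; exists set0; split => //.
    by rewrite measure0 lte_fin.
  have m0 := @measurable_mul_indic 0 _ (measurableC measurable0).
  rewrite inE; apply/andP; split; rewrite inE//=.
  rewrite /finite_norm; apply: (@le_lt_trans _ _ ('N[mu]_p%:E[EFin \o (cst 0%R : T -> R)])%E).
    apply: (@le_Lnorm_ae _ _ _ _ _ p1 _ (cst 0)) => //.
    by move: (L00E mu); apply: filterS => x /(_ I) /= ->; rewrite mul0r.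
  rewrite [X in ('N[_]__[X])%E](_ : _ = cst 0%E)// Lnorm0//.
  by rewrite eqe gt_eqF// (lt_le_trans _ p1).
by move=> a f g /[!inE]; exact: in_LambdaD.
Qed.

HB.instance Definition _ := GRing.isSubmodClosed.Build R (L0 mu)
  (Lambda_pred p1) Lambda_submod_closed.

Record Lambda := MkLambda {
  Lambda_val :> L0 mu;
  Lambda_valP : Lambda_val \in Lambda_pred p1 }.

HB.instance Definition _ := [isSub for Lambda_val].
HB.instance Definition _ := [Choice of Lambda by <:].
HB.instance Definition _ := [SubChoice_isSubLmodule of Lambda by <:].

Let measurable_min1 (f : L0 mu) : measurable_fun setT (fun x => minr `|f x| 1).
Proof.
apply: measurable_minr => //; apply: measurableT_comp => //.
Qed.

Let min1_ge0 (x : R) : 0 <= minr `|x| 1.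
Proof. by rewrite le_min normr_ge0 ler01. Qed.

Lemma alpha_norm_fin_num (f : Lambda) : alpha_norm f \is a fin_num.
Proof.
rewrite ge0_fin_numE ?Lnorm_ge0//.
have /[!inE]/= /(_ _ ltr01) [E [mE muE]] := Lambda_valP f.
rewrite inE => /andP[/[!inE]/= mfE fEoo].
have mindE : measurable_fun setT (\1_E : T -> R) by exact: measurable_indic.
pose u x := `|(f x * \1_(~` E) x : R)| + (\1_E x : R).
have mu_ : measurable_fun setT u.
  by apply: measurable_funD => //; apply: measurableT_comp.
apply: (@le_lt_trans _ _ 'N[mu]_p%:E[EFin \o u])%E.
  apply: le_Lnorm_ae => //; apply/aeW => x.
  have ux0 : 0 <= u x by rewrite addr_ge0// indicE.
  rewrite (ger0_norm (min1_ge0 _)) (ger0_norm ux0).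
  rewrite /u !indicE in_setC ge_min.
  by case: (x \in E); rewrite /= ?mulr1 ?mulr0 ?normr0 ?add0r ?addr0 lexx ?orbT.
apply: le_lt_trans (@minkowski_EFin _ _ _ mu _ _ p _ _ _) _ => //.
  exact: measurableT_comp.
rewrite lte_add_pinfty//; last first.
  by apply: finite_norm_indic => //; exact: (lt_trans muE (ltry _)).
apply: le_lt_trans fEoo; apply: le_Lnorm_ae => //; first exact: measurableT_comp.
by apply/aeW => x; rewrite normr_id.
Qed.

Lemma le_alpha_norm (f g : L0 mu) :
  (\forall x \ae mu, `|f x| <= `|g x|) -> (alpha_norm f <= alpha_norm g)%E.
Proof.
move=> fg; apply: le_Lnorm_ae => //; move: fg; apply: filterS => x fg.
by rewrite !(ger0_norm (min1_ge0 _)) le_min !ge_min fg lexx orbT.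
Qed.

Lemma alpha_norm0 : alpha_norm 0 = 0%E.
Proof.
have p0 : 0 < p by exact: lt_le_trans p1.
apply/eqP; rewrite eq_le Lnorm_ge0 andbT.
apply: (@le_trans _ _ ('N[mu]_p%:E[EFin \o (cst 0%R : T -> R)])%E).
  apply: (@le_Lnorm_ae _ _ _ _ _ p1 _ (cst 0)) => //.
  move: (L00E mu); apply: filterS => x /(_ I) /= ->.
  by rewrite normr0 min_l ?normr0.
by rewrite [X in ('N[_]__[X])%E](_ : _ = cst 0%E)// Lnorm0// eqe gt_eqF.
Qed.

Lemma alpha_norm_eq0 (f : L0 mu) : alpha_norm f = 0%E -> f = 0.
Proof.
have p0 : (0 < p%:E)%E by rewrite lte_fin (lt_le_trans _ p1).
move/(Lnorm_eq0_eq0 ((measurable_EFinP _ _).2 (measurable_min1 f)) p0).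
move=> f0; apply: L0_ext; move: f0 (L00E mu).
apply: filterS2 => x /(_ I) [fx0] /(_ I) -> _; move: fx0.
by case: (leP `|f x| 1) => [_ /normr0_eq0//|_ /eqP]; rewrite oner_eq0.
Qed.

Lemma alpha_normN (f : L0 mu) : alpha_norm (- f) = alpha_norm f.
Proof.
apply/eqP; rewrite eq_le; apply/andP; split; apply: le_alpha_norm;
  by move: (L0NE f); apply: filterS => x /(_ I) ->; rewrite /= normrN.
Qed.

Lemma alpha_normD (f g : L0 mu) :
  (alpha_norm (f + g)%R <= alpha_norm f + alpha_norm g)%E.
Proof.
apply: le_trans (@minkowski_EFin _ _ _ mu _ _ p _ _ _) => //.
apply: le_Lnorm_ae => //; first exact: measurable_funD.
move: (L0DE f g); apply: filterS => x /(_ I) /= ->.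
rewrite (ger0_norm (min1_ge0 _)).
rewrite (ger0_norm (addr_ge0 (min1_ge0 _) (min1_ge0 _))).
have fgx : `|f x + g x| <= `|f x| + `|g x| by exact: ler_normD.
have [f1|f1] := leP `|f x| 1; have [g1|g1] := leP `|g x| 1; rewrite ge_min.
- by rewrite fgx.
- by rewrite lerDr normr_ge0 orbT.
- by rewrite lerDl normr_ge0 orbT.
- by rewrite lerDl ler01 orbT.
Qed.

Definition Lambda_dist (f g : Lambda) : R := fine (alpha_norm (f - g)).

Lemma Lambda_distE f g :
  (Lambda_dist f g)%:E = alpha_norm ((f : L0 mu) - (g : L0 mu)).
Proof. by rewrite fineK//; exact: (alpha_norm_fin_num (f - g)). Qed.

Lemma Lambda_distxx f : Lambda_dist f f = 0.
Proof. by apply: EFin_inj; rewrite Lambda_distE subrr alpha_norm0. Qed.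

Lemma Lambda_dist_eq0 f g : Lambda_dist f g = 0 -> f = g.
Proof.
move=> fg; have : alpha_norm ((f : L0 mu) - (g : L0 mu)) = 0%E.
  by rewrite -Lambda_distE fg.
by move/alpha_norm_eq0/eqP; rewrite subr_eq0 => /eqP/val_inj.
Qed.

Lemma Lambda_dist_sym f g : Lambda_dist f g = Lambda_dist g f.
Proof. by apply: EFin_inj; rewrite !Lambda_distE -opprB alpha_normN. Qed.

Lemma Lambda_dist_triangle g f h :
  Lambda_dist f h <= Lambda_dist f g + Lambda_dist g h.
Proof.
rewrite -lee_fin EFinD !Lambda_distE (le_trans _ (alpha_normD _ _))//.
by rewrite addrA subrK.
Qed.

HB.instance Definition _ := @isMetric.Build R Lambda Lambda_dist
  Lambda_distxx Lambda_dist_eq0 Lambda_dist_sym Lambda_dist_triangle.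

End Lambda.

(* Not the library's locally_convex field of tvsType, which asks for a basis of
   convex open sets: here a neighbourhood base at 0 of convex sets. *)
Definition locally_convex_space (R : numDomainType)
    (E : preTopologicalLmodType R) :=
  exists2 B : set_system E,
    (forall U, B U -> nbhs 0 U /\ convex_set U) &
    (forall V, nbhs 0 V -> exists2 U, B U & U `<=` V).

(* Main.v *)
(** Cutting a set of measure [1] into [2 ^ k] pieces of measure [2 ^- k], its
    indicator is the average of the functions [2 ^ k *: chi], [chi] ranging over
    the indicators of the pieces.  Truncation at height [1] makes the
    alpha-norm of such a function equal to [2 ^ (- k / p)], whatever its height,
    so every convex neighbourhood of [0] contains a function of alpha-norm [1]
    and none is included in the unit ball. *)
Require Import Defs.
From mathcomp Require Import all_boot all_order all_algebra.
From mathcomp Require Import all_classical all_reals all_analysis.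
From mathcomp Require Import measurable_realfun ring.
Import Order.TTheory GRing.Theory Num.Def Num.Theory.
Import numFieldNormedType.Exports.

Set Implicit Arguments.
Unset Strict Implicit.
Unset Printing Implicit Defensive.

Local Open Scope classical_set_scope.
Local Open Scope ring_scope.

(** Convexity at the weight [2^-1], which is its own complement to [1]. Midpoints suffice below
    because every piece is cut into two halves. *)
Lemma convex_set_midpoint (R : numFieldType) (M : lmodType R)
    (A : set (convex_lmodType M)) (x y : M) :
  convex_set A -> A x -> A y -> A (2^-1 *: x + 2^-1 *: y).
Proof.
move=> cA Ax Ay.
have h0 : 0 <= 2^-1 :> R by rewrite invr_ge0.
have h1 : 2^-1 <= 1 :> R by rewrite invf_le1// ler1n.
have := cA _ _ (Itv01 h0 h1) (mem_set Ax) (mem_set Ay).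
rewrite inE; congr A; congr (_ + _ *: _) => /=.
by rewrite /unstable.onem [X in X - _]splitr mul1r addrK.
Qed.

Section indicator.
Context d (T : measurableType d) (R : realType).
Variables (mu : {measure set T -> \bar R}) (p : R) (p1 : 1 <= p).

Let p0 : 0 < p. Proof. exact: lt_le_trans p1. Qed.

Lemma Lnorm_indic E : measurable E ->
  ('N[mu]_p%:E[EFin \o (\1_E : T -> R)] = mu E `^ p^-1)%E.
Proof.
move=> mE; rewrite unlock; congr poweR.
rewrite (eq_integral (fun x => (\1_E x)%:E)); last first.
  move=> x _; rewrite /= indicE.
  by case: (x \in E); rewrite ?normr1 ?powR1// normr0 powR0// gt_eqF.
by rewrite integral_indic// setIT.
Qed.

Definition L0_indic E (mE : measurable E) : L0 mu := L0_class mu (mindic R mE).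

Lemma L0_indicE E (mE : measurable E) :
  (L0_indic mE : T -> R) = \1_E %[ae mu].
Proof. exact: L0_classE. Qed.

Lemma Lambda_indic_subproof E (mE : measurable E) : (mu E < +oo)%E ->
  L0_indic mE \in Lambda_pred p1.
Proof.
(* An indicator of finite measure is already in [L_p], so the empty exceptional set works for every
   [delta]. *)
move=> Eoo; rewrite inE => /= delta delta0; exists set0; split => //.
  by rewrite measure0 lte_fin.
have mf : measurable_fun setT ((L0_indic mE : T -> R) \* \1_(~` set0)).
  apply: measurable_funM; first exact: measurable_L0.
  by apply: measurable_indic; exact: measurableC.
rewrite inE; apply/andP; split; rewrite inE//=.
apply: le_lt_trans (finite_norm_indic p1 mE Eoo).
apply: le_Lnorm_ae => //.
move: (L0_indicE mE); apply: filterS => x /(_ I) /= ->.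
by rewrite setC0 indicT mulr1.
Qed.

Definition Lambda_indic E (mE : measurable E) (Eoo : (mu E < +oo)%E) :
  Lambda mu p1 := MkLambda (Lambda_indic_subproof mE Eoo).

(** Since [1 <= c], truncation at [1] turns [c *: \1_E] back into [\1_E] and the height [c] is
    lost. *)
Lemma alpha_norm_scale_indic E (mE : measurable E) (c : R) : 1 <= c ->
  alpha_norm p (c *: L0_indic mE) = (mu E `^ p^-1)%E.
Proof.
move=> c1; rewrite -Lnorm_indic//.
have mf : measurable_fun setT (fun x => minr `|(c *: L0_indic mE : L0 mu) x| 1).
  by apply: measurable_minr => //; apply: measurableT_comp.
have fE : \forall x \ae mu,
    `|minr `|(c *: L0_indic mE : L0 mu) x| 1| = `|\1_E x : R|.
  move: (L0ZE c (L0_indic mE)) (L0_indicE mE).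
  apply: filterS2 => x /(_ I) -> /(_ I) /= ->; rewrite indicE.
  case: (x \in E); last by rewrite scaler0 normr0 min_l ?normr0.
  by rewrite /= [c *: _]mulr1 (ger0_norm (le_trans ler01 c1)) min_r.
apply/eqP; rewrite eq_le; apply/andP; split; apply: le_Lnorm_ae => //;
  by move: fE; apply: filterS => x ->.
Qed.

Lemma L0_indicU E F (mE : measurable E) (mF : measurable F)
    (mEF : measurable (E `|` F)) : E `&` F = set0 ->
  L0_indic mEF = L0_indic mE + L0_indic mF.
Proof.
move=> EF; apply: L0_ext.
have := ae_and (L0DE (L0_indic mE) (L0_indic mF)) (L0_indicE mEF).
move: (L0_indicE mE) (L0_indicE mF).
apply: filterS3 => x /(_ I) E1 /(_ I) E2 [/(_ I) E3 /(_ I) E4] _.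
have : x \in E `&` F = false by rewrite EF in_set0.
rewrite E3 E4/= E1 E2 !indicE in_setI in_setU.
by case: (x \in E); case: (x \in F); rewrite //= ?addr0 ?add0r.
Qed.

(** The sets [A k i] form binary trees: each piece of level [k] is halved into its two children of
    level [k.+1]. Averaging over all pieces then amounts to taking midpoints level by level. The
    index [i] is left unbounded, so that each level is treated uniformly. *)
Lemma Lambda_not_locally_convex (A : nat -> nat -> set T) :
  (forall k i, measurable (A k i)) ->
  (forall k i, mu (A k i) = (2^-1 ^+ k)%:E) ->
  (forall k i, A k i = A k.+1 i.*2 `|` A k.+1 i.*2.+1) ->
  (forall k i, A k.+1 i.*2 `&` A k.+1 i.*2.+1 = set0) ->
  ~ locally_convex_space (Lambda mu p1).
Proof.
move=> mA muA AU AI [B nbhs_convex baseB].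
have Aoo k i : (mu (A k i) < +oo)%E by rewrite muA ltry.
(* The height doubles at each level, which offsets the factor [2^-1] of the midpoint in [fS]. *)
pose f k i : Lambda mu p1 := 2 ^+ k *: Lambda_indic (mA k i) (Aoo k i).
have distf k i : (Lambda_dist 0 (f k i))%:E = ((2^-1 ^+ k) `^ p^-1)%:E.
  rewrite Lambda_dist_sym Lambda_distE subr0.
  rewrite [LHS](alpha_norm_scale_indic (mA k i)) ?muA//.
  by rewrite exprn_ege1// ler1n.
have fS k i : f k i = 2^-1 *: f k.+1 i.*2 + 2^-1 *: f k.+1 i.*2.+1.
  rewrite /f !scalerA exprS mulKf// -scalerDr; congr (_ *: _).
  apply/val_inj => /=.
  (* The two proofs mention [A k i] in their types and must be generalized before it is
     rewritten. *)
  move: (mA k i) (Aoo k i); rewrite AU => mU Uoo.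
  exact: L0_indicU.
have [U BU UB] : exists2 U, B U & U `<=` ball (0 : Lambda mu p1) 1.
  by apply: baseB; exact: nbhsx_ballx.
have [nbhsU convexU] := nbhs_convex _ BU.
have [e /= e0 eU] : exists2 e : R, 0 < e & ball (0 : Lambda mu p1) e `<=` U.
  by apply/nbhs_ballP.
have small : exists k, forall i, U (f k i).
  have ep : 0 < e `^ p by exact: powR_gt0.
  have [k _ /(_ _ (leqnn k)) ke] := near_infty_natSinv_expn_lt (PosNum ep).
  exists k => i; apply: eU; rewrite /ball/= -lte_fin distf lte_fin.
  have -> : e = (e `^ p) `^ p^-1.
    by rewrite -powRrM divff ?gt_eqF// powRr1// ltW.
  apply: gt0_ltr_powR; rewrite ?invr_gt0// ?nnegrE ?exprn_ge0// ?powR_ge0//.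
  by rewrite exprVn -div1r.
have shrink k : (forall i, U (f k.+1 i)) -> forall i, U (f k i).
  by move=> Uf i; rewrite fS; exact: convex_set_midpoint.
have [k Uk] := small.
have U0 : forall i, U (f 0 i) by elim: k Uk => // k IH /shrink.
(* At level [0] the distance to the origin is exactly [1], which the strict inequality of the ball
   excludes. *)
have := UB _ (U0 0); rewrite /ball/= -lte_fin distf.
by rewrite expr0 powR1 ltxx.
Qed.

End indicator.

Section dyadic_slab.
Context (R : realType) (n : nat).

(** Only the first coordinate is cut. Half-open intervals make the two halves disjoint with union
    the whole side. For [i] at least [2 ^ k] the slab leaves the unit cube but keeps the same
    measure. *)
Definition dyadic_side (k i : nat) (j : 'I_n.+1) : set (measurableTypeR R) :=
  if j == ord0 then `[i%:R / 2 ^+ k, i.+1%:R / 2 ^+ k[%classic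
  else `[0, 1[%classic.

Definition dyadic_slab k i : set (n.+1.-tuple (measurableTypeR R)) :=
  [set t | forall j, dyadic_side k i j (tnth t j)].

Let measurable_dyadic_side k i j : measurable (dyadic_side k i j).
Proof. by rewrite /dyadic_side; case: ifP => _; exact: measurable_itv. Qed.

Lemma measurable_dyadic_slab k i : measurable (dyadic_slab k i).
Proof.
rewrite (_ : dyadic_slab k i = \bigcap_(j in [set: 'I_n.+1])
    ((fun t => tnth t j) @^-1` dyadic_side k i j)); last first.
  by apply/seteqP; split => [t At j _|t At j]; [exact: At|exact: (At j)].
apply: fin_bigcap_measurable => // j _.
by rewrite -[X in measurable X]setTI; exact: measurable_tnth.
Qed.

Lemma lebesgue_measure_dyadic_slab k i :
  lebesgue_measure_tuple R n.+1 (dyadic_slab k i) = (2^-1 ^+ k)%:E.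
Proof.
rewrite lebesgue_measure_tuple_box// big_ord_recl big1 ?mule1 => [|j _].
  rewrite /dyadic_side eqxx lebesgue_measure_itv/= lte_fin.
  rewrite ltr_pM2r ?invr_gt0 ?exprn_gt0// ltr_nat ltnSn -EFinB -mulrBl.
  by rewrite -natrB// subSnn mul1r exprVn.
by rewrite /dyadic_side/= lebesgue_measure_itv/= lte_fin ltr01 oppr0 adde0.
Qed.

Let dyadic_sideS k i : `[i%:R / 2 ^+ k, i.+1%:R / 2 ^+ k[%classic =
  `[i.*2%:R / 2 ^+ k.+1, i.*2.+1%:R / 2 ^+ k.+1[ `|`
  `[i.*2.+1%:R / 2 ^+ k.+1, i.*2.+2%:R / 2 ^+ k.+1[ :> set R.
Proof.
have half (m : nat) : m%:R / 2 ^+ k = m.*2%:R / 2 ^+ k.+1 :> R.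
  rewrite -muln2 natrM exprS.
  by field; rewrite gt_eqF ?exprn_gt0.
have mono (m : nat) : m%:R / 2 ^+ k.+1 <= m.+1%:R / 2 ^+ k.+1 :> R.
  by rewrite ler_pM2r ?invr_gt0 ?exprn_gt0// ler_nat.
rewrite !half doubleS.
by rewrite (itv_bndbnd_setU (x := BLeft (i.*2.+1%:R / 2 ^+ k.+1))) ?bnd_simp.
Qed.

Lemma dyadic_slabS k i :
  dyadic_slab k i = dyadic_slab k.+1 i.*2 `|` dyadic_slab k.+1 i.*2.+1.
Proof.
apply/seteqP; split => [t At|t [] At j].
- have := At ord0; rewrite /dyadic_side eqxx dyadic_sideS.
  (* The first coordinate decides the half; the other sides depend on neither [k] nor [i]. *)
  by case=> At0; [left|right] => j; move: At0 (At j); rewrite /dyadic_side;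
    case: eqP => // ->.
- have := At j; rewrite /dyadic_side; case: ifP => // _ Atj.
  by rewrite dyadic_sideS; left.
- have := At j; rewrite /dyadic_side; case: ifP => // _ Atj.
  by rewrite dyadic_sideS; right.
Qed.

Lemma dyadic_slabI k i : dyadic_slab k i `&` dyadic_slab k i.+1 = set0.
Proof.
apply/seteqP; split => // t [/(_ ord0) + /(_ ord0)].
rewrite /dyadic_side eqxx/= !in_itv/= => /andP[_ lt] /andP[/(lt_le_trans lt)].
by rewrite ltxx.
Qed.

End dyadic_slab.

Theorem proposition7p2 (R : realType) (d : nat) (d_gt0 : (0 < d)%N)
    (p : R) (p1 : 1 <= p) :
  ~ locally_convex_space (Lambda (lebesgue_measure_tuple R d) p1).
Proof.
(* Positive dimension provides the coordinate to be cut. *)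
case: d d_gt0 => // n _.
apply: (@Lambda_not_locally_convex _ _ _ _ _ _ (@dyadic_slab R n)).
- exact: measurable_dyadic_slab.
- exact: lebesgue_measure_dyadic_slab.
- exact: dyadic_slabS.
- by move=> k i; exact: dyadic_slabI.
Qed.
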